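(* Let $B$ and $\delta B$ be smooth compactly supported vector fields $\mathbb{R}^3\to\mathbb{R}^3$. Then the Gateaux derivative of the forward map $\mathcal{S}$ at $B$ in the direction $\delta B$ is given, for every $x\in\mathbb{R}^3$ and every unit vector $\xi\in\mathbb{R}^3$, by $$D\mathcal{S}_B(\delta B)(x,\xi)=\frac{\gamma_N}{v}\,\mathcal{S}(B)(x,\xi)\,H\left(\int_{-\infty}^{\infty}\Sigma(x+s\xi,\xi)^T\,\delta B(x+s\xi)\,ds\right),$$ where $\Sigma$ is the matrix solution of the transport equation associated with $B$.
   Context: Here $\gamma_N\neq 0$ and $v>0$ are fixed real constants. For $b=(b_1,b_2,b_3)\in\mathbb{R}^3$, $$H(b)=\begin{pmatrix} 0 & b_3 & -b_2 \\ -b_3 & 0 & b_1 \\ b_2 & -b_1 & 0 \end{pmatrix}.$$ For a vector field $B$, the associated $3\times3$ matrix-valued function $\Sigma$ is the solution, along each line $s\mapsto x+s\xi$ with $|\xi|=1$, of $$\frac{\partial}{\partial s}\Sigma(x+s\xi,\xi)=\frac{\gamma_N}{v}H(B(x+s\xi))\,\Sigma(x+s\xi,\xi),\qquad \lim_{s\to-\infty}\Sigma(x+s\xi,\xi)=I.$$ The forward map is $\mathcal{S}(B)(x,\xi)=\lim_{s\to\infty}\Sigma(x+s\xi,\xi)$. The Gateaux derivative is $D\mathcal{S}_B(\delta B)(x,\xi)=\left.\frac{d}{d\epsilon}\right|_{\epsilon=0}\mathcal{S}(B+\epsilon\,\delta B)(x,\xi)$. *)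

(* Defs.v *)
From HB Require Import structures.
From mathcomp Require Import all_boot all_order all_algebra.
From mathcomp Require Import all_classical all_reals all_analysis.

Set Implicit Arguments.
Unset Strict Implicit.
Unset Printing Implicit Defensive.

Import Order.TTheory GRing.Theory Num.Theory.
Import numFieldNormedType.Exports.

Local Open Scope classical_set_scope.
Local Open Scope ring_scope.

Section Defs.
Variable R : realType.

(* The library norm on 'cV[R]_3 is the sup norm, hence a separate definition. *)
Definition enorm (x : 'cV[R]_3) : R := Num.sqrt (\sum_i x i 0 ^+ 2).

(* f is C^k: its iterated partial derivatives up to order k exist everywhere
   and are continuous; delta_mx i 0 is the i-th vector of the standard basis. *)
Fixpoint Ck (k : nat) (f : 'cV[R]_3 -> 'cV[R]_3) : Prop :=
  continuous f /\
  if k is l.+1 then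
    forall i : 'I_3, (forall x, derivable f x (delta_mx i 0)) /\
                     Ck l (fun x => 'D_(delta_mx i 0) f x)
  else True.

Definition smooth (f : 'cV[R]_3 -> 'cV[R]_3) : Prop := forall k, Ck k f.

Definition compactly_supported (f : 'cV[R]_3 -> 'cV[R]_3) : Prop :=
  compact (closure [set x | f x != 0]).

Definition H (b : 'cV[R]_3) : 'M[R]_3 :=
  let b1 := b 0 0 in let b2 := b 1 0 in let b3 := b 2 0 in
  \matrix_(i < 3, j < 3)
    nth 0 (nth [::] [:: [::    0;   b3; - b2];
                        [:: - b3;    0;   b1];
                        [::   b2; - b1;    0]] i) j.

(* Sg y xi is the value at the point y and in the direction xi; only unit
   directions are constrained. *)
Definition is_transport_solution (gammaN v : R) (B : 'cV[R]_3 -> 'cV[R]_3)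
    (Sg : 'cV[R]_3 -> 'cV[R]_3 -> 'M[R]_3) : Prop :=
  forall x xi : 'cV[R]_3, enorm xi = 1 ->
    (forall s : R,
       is_derive s 1 (fun t : R => Sg (x + t *: xi) xi)
         ((gammaN / v) *: (H (B (x + s *: xi)) *m Sg (x + s *: xi) xi))) /\
    Sg (x + s *: xi) xi @[s --> -oo] --> (1%:M : 'M[R]_3).

(* The solution of the transport equation associated with B, selected by
   classical choice; the default value is taken only if there is none. *)
Definition Sigma (gammaN v : R) (B : 'cV[R]_3 -> 'cV[R]_3) :
    'cV[R]_3 -> 'cV[R]_3 -> 'M[R]_3 :=
  xget (fun _ _ => 1%:M) [set Sg | is_transport_solution gammaN v B Sg].

Definition forward (gammaN v : R) (B : 'cV[R]_3 -> 'cV[R]_3)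
    (x xi : 'cV[R]_3) : 'M[R]_3 :=
  lim (Sigma gammaN v B (x + s *: xi) xi @[s --> +oo]).

Definition perturbed_forward (gammaN v : R) (B dB : 'cV[R]_3 -> 'cV[R]_3)
    (x xi : 'cV[R]_3) (eps : R) : 'M[R]_3 :=
  forward gammaN v (fun y => B y + eps *: dB y) x xi.

Definition gateaux_forward (gammaN v : R) (B dB : 'cV[R]_3 -> 'cV[R]_3)
    (x xi : 'cV[R]_3) : 'M[R]_3 :=
  ((perturbed_forward gammaN v B dB x xi)^`() 0)%classic.

Definition integral_cV (f : R -> 'cV[R]_3) : 'cV[R]_3 :=
  \col_(i < 3) Rintegral (@lebesgue_measure R) setT (fun s => f s i 0).

End Defs.

(* Main.v *)
(* Since H(b) is antisymmetric, every solution of the transport equation along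
   a line is orthogonal, which gives uniqueness and uniform bounds; existence
   comes from Picard iteration. Let U_e be the solution for B + e dB on the
   line. Then W = U_0^T U_e satisfies W' = e (gamma / v) U_0^T H(dB) U_0 W, and
   U_0^T H(b) U_0 = H(U_0^T b) because U_0 is a rotation. Hence
   W = 1 + e (gamma / v) H(\int U_0^T dB) + O(e^2) beyond the supports, and
   multiplying by U_0 gives the derivative of the forward map. *)
Require Import Defs.
From HB Require Import structures.
From mathcomp Require Import all_boot all_order all_algebra.
From mathcomp Require Import all_classical all_reals all_analysis.
From mathcomp Require Import ring lra.
Set Implicit Arguments.
Unset Strict Implicit.
Unset Printing Implicit Defensive.

Import Order.TTheory GRing.Theory Num.Theory.
Import numFieldNormedType.Exports.
Local Open Scope classical_set_scope.
Local Open Scope ring_scope.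

(** * Calculus of real and matrix-valued functions *)

(** Integrating from -oo makes the antiderivative vanish up to [a] without distinguishing signs; the
    integral makes sense because [f] vanishes on the left. *)
Lemma antiderivative_exists (R : realType) (f : R -> R) (a : R) :
  continuous f -> (forall s, s <= a -> f s = 0) ->
  exists F : R -> R, (forall s : R, is_derive s 1 F (f s)) /\
    (forall s, s <= a -> F s = 0).
Proof.
move=> cf f0.
have intf (y : R) : (@lebesgue_measure R).-integrable `]-oo, y] (EFin \o f).
  apply/integrable_mkcond => //.
  (* Left of [a] the function is zero, so only a compact segment contributes. *)
  rewrite (_ : _ \_ _ = (EFin \o f) \_ `[a, y]); last first.
    apply/funext => x; rewrite !patchE/= !mem_setE !in_itv/=.
    have [|ax] := leP a x => //=.
    by case: ifP => // _; rewrite f0// ltW.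
  apply: (iffLR (integrable_mkcond _ _)) => //.
  apply: continuous_compact_integrable; first exact: segment_compact.
  exact: continuous_subspaceT.
pose F y := (\int[@lebesgue_measure R]_(t in [set` `]-oo, y]]) f t)%R.
exists F; split => s.
  have [dF F'] : derivable F s 1 /\ derive1 F s = f s.
    apply: (continuous_FTC1 (u := s + 1)) => //.
      by rewrite ltrDl.
      by rewrite ltNyr.
    exact: cf.
  by split; rewrite -?derive1E.
move=> sa; rewrite /F /Rintegral integral0_eq//= => x.
by rewrite in_itv/= => xs; rewrite f0// (le_trans xs).
Qed.

(** By the mean value theorem [g - f] and [g + f] do not decrease after [a]. This comparison stands
    in for integral estimates below. *)
Lemma derive_bound (R : realType) (f g df dg : R -> R) (a : R) :
  (forall s : R, is_derive s 1 f (df s)) ->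
  (forall s : R, is_derive s 1 g (dg s)) ->
  (forall s, a <= s -> `|df s| <= dg s) -> `|f a| <= g a ->
  forall s, a <= s -> `|f s| <= g s.
Proof.
move=> hf hg le_df_dg le_fa_ga s sa.
have mono (h dh : R -> R) : (forall s : R, is_derive s 1 h (dh s)) ->
    (forall s, a <= s -> 0 <= dh s) -> h a <= h s.
  move=> h' dh_ge0.
  have [c ac] : exists2 c, c \in `[a, s] & h s - h a = dh c * (s - a).
    apply: (MVT_segment sa (fun x _ => h' x)).
    apply: derivable_within_continuous => x _.
    exact: ex_derive.
  move=> E; rewrite -subr_ge0 E mulr_ge0 ?subr_ge0 ?dh_ge0//.
  by move: ac; rewrite in_itv/= => /andP[].
have h1 := mono _ _ (fun s => is_deriveB (hg s) (hf s)).
have h2 := mono _ _ (fun s => is_deriveD (hg s) (hf s)).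
have {}h1 : (g - f) a <= (g - f) s.
  apply: h1 => t /le_df_dg; rewrite ler_norml => /andP[]; lra.
have {}h2 : (g + f) a <= (g + f) s.
  apply: h2 => t /le_df_dg; rewrite ler_norml => /andP[]; lra.
move: h1 h2 le_fa_ga; rewrite /= !fctE !ler_norml => h1 h2 /andP[h3 h4].
by apply/andP; split; lra.
Qed.

Lemma submxE (V : zmodType) m n (M N : 'M[V]_(m, n)) i j :
  (M - N) i j = M i j - N i j.
Proof. by rewrite !mxE. Qed.

Lemma scalemxE (R : pzSemiRingType) m n k (M : 'M[R]_(m, n)) i j :
  (k *: M) i j = k * M i j.
Proof. by rewrite mxE. Qed.

Lemma is_derive_mxP (R : realType) m n (M : R -> 'M[R]_(m, n)) (t : R)
    (dM : 'M[R]_(m, n)) :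
  is_derive t 1 M dM <->
  forall i j, is_derive t 1 (fun s => M s i j) (dM i j).
Proof.
split=> [[Mt <-] i j|Mt].
  apply: DeriveDef; first by move/derivable_mxP: Mt; exact.
  by rewrite derive_mx// mxE.
have dMt : derivable M t 1 by apply/derivable_mxP => i j; exact: ex_derive.
apply: DeriveDef => //; rewrite derive_mx//; apply/matrixP => i j.
by rewrite mxE; exact: derive_val.
Qed.

Lemma is_derive_mulmx (R : realType) m n p (M : R -> 'M[R]_(m, n))
    (N : R -> 'M[R]_(n, p)) (t : R) dM dN :
  is_derive t 1 M dM -> is_derive t 1 N dN ->
  is_derive t 1 (fun s => M s *m N s) (dM *m N t + M t *m dN).
Proof.
move=> /is_derive_mxP hM /is_derive_mxP hN; apply/is_derive_mxP => i j.
rewrite (_ : (fun s => _) =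
    \sum_k ((fun s => M s i k) * (fun s => N s k j))); last first.
  by apply/funext => s; rewrite fct_sumE mxE.
rewrite !mxE -big_split/=.
apply: is_derive_sum => k; apply: is_derive_eq.
by rewrite addrC; congr (_ + _); exact: mulrC.
Qed.

Lemma is_derive_trmx (R : realType) m n (M : R -> 'M[R]_(m, n)) (t : R) dM :
  is_derive t 1 M dM -> is_derive t 1 (fun s => (M s)^T) dM^T.
Proof.
move=> /is_derive_mxP hM; apply/is_derive_mxP => i j; rewrite mxE.
by rewrite (_ : (fun s => _) = (fun s => M s j i))//; apply/funext => s;
  rewrite mxE.
Qed.

Lemma is_derive_mx_continuous (R : realType) m n (M dM : R -> 'M[R]_(m, n)) :
  (forall t : R, is_derive t 1 M (dM t)) ->
  forall i j, continuous (fun s => M s i j).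
Proof.
move=> hM i j s; apply: differentiable_continuous; apply/derivable1_diffP.
by have /is_derive_mxP/(_ i j) [] := hM s.
Qed.

Lemma is_derive0_mx_cst (R : realType) m n (M : R -> 'M[R]_(m, n)) :
  (forall t : R, is_derive t 1 M 0) -> forall s t, M s = M t.
Proof.
move=> hM s t; apply/matrixP => i j.
apply: (is_derive_0_is_cst (f := fun s => M s i j)) => u.
by have /is_derive_mxP/(_ i j) := hM u; rewrite mxE.
Qed.

Lemma is_derive0_mx_cst_itv (R : realType) m n (M dM : R -> 'M[R]_(m, n))
    (s a : R) :
  s <= a -> (forall t : R, is_derive t 1 M (dM t)) ->
  (forall t, s <= t <= a -> dM t = 0) -> M s = M a.
Proof.
move=> sa hM dM0; apply/matrixP => i j.
have hMij (x : R) : is_derive x 1 (fun s => M s i j) (dM x i j).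
  by have /is_derive_mxP := hM x; exact.
have [c ac] : exists2 c, c \in `[s, a] &
    M a i j - M s i j = dM c i j * (a - s).
  apply: (MVT_segment sa (fun x _ => hMij x)).
  apply: derivable_within_continuous => x _.
  exact: ex_derive.
by move: ac; rewrite in_itv/= => /dM0 ->; rewrite mxE mul0r => /eqP;
  rewrite subr_eq0 => /eqP.
Qed.

Lemma mulmx_bound (R : realType) m n p (A : 'M[R]_(m, n)) (B : 'M[R]_(n, p))
    (a b : R) :
  (forall i j, `|A i j| <= a) -> (forall i j, `|B i j| <= b) ->
  forall i j, `|(A *m B) i j| <= n%:R * (a * b).
Proof.
move=> hA hB i j; rewrite mxE (le_trans (ler_norm_sum _ _ _))//.
rewrite mulr_natl -[n in leRHS]card_ord -sumr_const ler_sum// => k _.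
by rewrite normrM ler_pM.
Qed.

(** Lowering and raising [u k] by [2 * c / 2 ^+ k] gives a nondecreasing sequence below a
    nonincreasing one; the supremum of the lower one is the limit. *)
Lemma geometric_limit_exists (R : realType) (u : nat -> R) (c : R) :
  (forall k, `|u k.+1 - u k| <= c / 2 ^+ k) ->
  exists l, forall k, `|u k - l| <= 2 * c / 2 ^+ k.
Proof.
move=> hu.
pose a k := u k - 2 * c / 2 ^+ k; pose b k := u k + 2 * c / 2 ^+ k.
have half k : 2 * c / 2 ^+ k.+1 = c / 2 ^+ k :> R.
  by rewrite exprS; field; rewrite expf_neq0 ?pnatr_eq0.
have c0 : 0 <= c by have := le_trans (normr_ge0 _) (hu 0); rewrite expr0 divr1.
have ck0 k : 0 <= c / 2 ^+ k by rewrite divr_ge0 ?exprn_ge0.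
have andecr : {homo a : m n / (m <= n)%N >-> m <= n}.
  apply: homo_leq => // [? ? ?|k]; first exact: le_trans.
  by rewrite /a half; move: (hu k); rewrite ler_norml => /andP[]; lra.
have bnincr : {homo b : m n / (m <= n)%N >-> n <= m}.
  apply: homo_leq => // [? ? ? + /le_trans|k]; first by move=> h; apply.
  by rewrite /b half; move: (hu k); rewrite ler_norml => /andP[]; lra.
have ab k m : a k <= b m.
  rewrite (le_trans (andecr _ _ (leq_maxl k m)))//.
  rewrite (le_trans _ (bnincr _ _ (leq_maxr k m)))//.
  rewrite /a /b -lerBlDl; have := ck0 (maxn k m); lra.
exists (sup (range a)) => k.
have ha : a k <= sup (range a).
  apply: ub_le_sup; last by exists k.
  by exists (b 0) => _ [j _ <-].
have hb : sup (range a) <= b k.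
  by apply: ge_sup; [exists (a 0), 0|move=> _ [j _ <-]].
by rewrite ler_norml; move: ha hb; rewrite /a /b; lra.
Qed.

Lemma geometric_bound_eq0 (R : realType) (x c : R) :
  (forall k, `|x| <= c / 2 ^+ k) -> x = 0.
Proof.
move=> hx; apply/eqP; rewrite -normr_le0; apply/ler_addgt0Pl => e e0.
rewrite addr0.
have : (fun k => c * 2^-1 ^+ k) @ \oo --> c * 0.
  apply: cvgM; first exact: cvg_cst.
  by apply: cvg_expr; rewrite ger0_norm ?invr_ge0// invf_lt1// ltr1n.
rewrite mulr0 => /cvgrPdist_lt/(_ _ e0)[k _ /(_ k (leqnn k))]/=.
rewrite sub0r normrN => h; rewrite (le_trans (hx k))// ltW//.
by rewrite (le_lt_trans _ h)// -exprVn ler_norm.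
Qed.

(** Continuity of [K] makes the convergence locally uniform, and the usual argument with [e / 3]
    applies. *)
Lemma geometric_limit_continuous (R : realType) (f : R -> R) (u : nat -> R -> R)
    (K : R -> R) :
  (forall k, continuous (u k)) -> continuous K ->
  (forall k s, `|u k s - f s| <= K s / 2 ^+ k) -> continuous f.
Proof.
move=> cu cK huf s; apply/cvgrPdist_lt => e e0.
have K0 : 0 <= K s by have := le_trans (normr_ge0 _) (huf 0 s);
  rewrite expr0 divr1.
(* The margin in [K s + 1] lets one [k] serve at [s] and at all [t] near [s]. *)
have [k hk] : exists k, (K s + 1) / 2 ^+ k < e / 3.
  apply: contrapT => /forallNP hk.
  have : e / 3 = 0.
    apply: (@geometric_bound_eq0 _ _ (K s + 1)) => k.
    rewrite ger0_norm; last by rewrite divr_ge0// ltW.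
    by rewrite leNgt; exact/negP.
  by move=> /eqP; rewrite mulf_eq0 invr_eq0 pnatr_eq0 gt_eqF.
near=> t.
have ht : `|u k s - u k t| < e / 3.
  by near: t; apply: (cvgrPdist_lt _ _).1; [exact: cu|rewrite divr_gt0].
have hK : K t < K s + 1.
  by near: t; apply: (cvgr_lt (K s)); [exact: cK|rewrite ltrDl].
have h1 := huf k s; have h2 := huf k t.
have {h1} : `|u k s - f s| < e / 3.
  rewrite (le_lt_trans h1)// (le_lt_trans _ hk)//.
  by rewrite ler_pM2r ?invr_gt0 ?exprn_gt0// lerDl.
have {h2} : `|u k t - f t| < e / 3.
  rewrite (le_lt_trans h2)// (le_lt_trans _ hk)//.
  by rewrite ler_pM2r ?invr_gt0 ?exprn_gt0// ltW.
move: ht; rewrite !ltr_norml => /andP[? ?] /andP[? ?] /andP[? ?].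
by apply/andP; split; lra.
Unshelve. all: by end_near. Qed.

Lemma continuous_mulmx (R : realType) m n p (M : R -> 'M[R]_(m, n))
    (N : R -> 'M[R]_(n, p)) :
  (forall i j, continuous (fun s => M s i j)) ->
  (forall i j, continuous (fun s => N s i j)) ->
  forall i j, continuous (fun s => (M s *m N s) i j).
Proof.
move=> cM cN i j.
rewrite (_ : (fun s => _) = (fun s => \sum_k M s i k * N s k j)); last first.
  by apply/funext => s; rewrite mxE.
move=> s; apply: cvg_big => [|k _]; first exact: add_continuous.
by apply: cvgM; [exact: cM|exact: cN].
Qed.

(** * Linear differential equations *)

(* Picard iteration, contracting by 1/2 in the norm weighted by
   [expR (L * (s - a))] as soon as L is twice the Lipschitz constant. *)
Lemma linear_ode_exists (R : realType) n (A : R -> 'M[R]_n) (a M : R) :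
  (forall i j, continuous (fun s => A s i j)) ->
  (forall s, s <= a -> A s = 0) ->
  0 <= M -> (forall s i j, `|A s i j| <= M) ->
  exists U : R -> 'M[R]_n, (forall s : R, is_derive s 1 U (A s *m U s)) /\
    (forall s, s <= a -> U s = 1%:M).
Proof.
move=> cA A0 M0 AM.
(* [I] is an antiderivative operator, made total by an arbitrary value where the conditions fail. *)
have /choice[I HI] : forall f : R -> R, exists F : R -> R,
    continuous f -> (forall s, s <= a -> f s = 0) ->
    (forall s : R, is_derive s 1 F (f s)) /\ (forall s, s <= a -> F s = 0).
  move=> f.
  have [[cf f0]|cf0] := pselect (continuous f /\ forall s, s <= a -> f s = 0).
    by have [F HF] := antiderivative_exists cf f0; exists F.
  by exists f => cf f0; case: cf0.
pose cont (X : R -> 'M[R]_n) := forall i j, continuous (fun s => X s i j).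
(* The Picard operator. As [A] vanishes up to [a], the integral effectively starts at [a], so a
   fixed point is a solution equal to 1 up to [a]. *)
pose Phi (X : R -> 'M[R]_n) s : 'M[R]_n :=
  1%:M + \matrix_(i, j) I (fun t => (A t *m X t) i j) s.
have AX0 (X : R -> 'M[R]_n) i j s : s <= a -> (A s *m X s) i j = 0.
  by move=> sa; rewrite A0// mul0mx mxE.
have dPhi X : cont X -> forall s : R, is_derive s 1 (Phi X) (A s *m X s).
  move=> cX s; apply/is_derive_mxP => i j.
  have [h _] := HI _ (@continuous_mulmx _ _ _ _ _ _ cA cX i j) (AX0 X i j).
  rewrite (_ : (fun s => _) = cst ((1%:M : 'M[R]_n) i j) +
      I (fun t => (A t *m X t) i j)); last first.
    by apply/funext => t; rewrite /Phi !mxE.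
  by apply: is_derive_eq; rewrite add0r.
have Phi1 X : cont X -> forall s, s <= a -> Phi X s = 1%:M.
  move=> cX s sa; apply/matrixP => i j.
  have [_ h] := HI _ (@continuous_mulmx _ _ _ _ _ _ cA cX i j) (AX0 X i j).
  by rewrite /Phi !mxE h// addr0.
have cPhi X : cont X -> cont (Phi X).
  by move=> cX; apply: is_derive_mx_continuous; exact: dPhi.
(* [n%:R * M] is the Lipschitz constant of the equation; the summand 1 keeps [L >= 2], which the
   bound on the first increment uses. *)
pose L : R := 2 * (n%:R * M + 1).
have nM0 : 0 <= n%:R * M by rewrite mulr_ge0.
pose E s := expR (L * (s - a)).
have E0 s : 0 <= E s by exact: expR_ge0.
have dE c (s : R) : is_derive s 1 (fun s => c * E s) (c * (L * E s)).
  rewrite (_ : (fun s => _) = c \*: (expR \o (L \*: (id - cst a))))//.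
  apply: is_deriveZ; rewrite mulrC; apply: is_derive1_comp.
  by apply: is_derive_eq; rewrite subr0; exact: mulr1.
(* The contraction: the derivative of [c / 2 * E] dominates [n%:R * M * (c * E)], since half of [L]
   exceeds [n%:R * M]. *)
have contr X Y c : cont X -> cont Y -> 0 <= c ->
    (forall s i j, `|X s i j - Y s i j| <= c * E s) ->
    forall s i j, `|Phi X s i j - Phi Y s i j| <= c / 2 * E s.
  move=> cX cY c0 XY s i j.
  have [sa|/ltW sa] := leP s a.
    by rewrite !Phi1// subrr normr0 !mulr_ge0// invr_ge0.
  have hXY (t : R) : is_derive t 1 (fun s => Phi X s i j - Phi Y s i j)
      ((A t *m (X t - Y t)) i j).
    have /is_derive_mxP/(_ i j) hX := dPhi _ cX t.
    have /is_derive_mxP/(_ i j) hY := dPhi _ cY t.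
    by rewrite mulmxBr !mxE; move: hX hY; rewrite !mxE; exact: is_deriveB.
  apply: (derive_bound hXY (dE (c / 2)) _ _ sa) => [t ta|].
    have {}XY i' j' : `|(X t - Y t) i' j'| <= c * E t by rewrite !mxE.
    rewrite (le_trans (mulmx_bound (AM t) XY i j))//.
    rewrite (_ : c / 2 * (L * E t) = n%:R * M * (c * E t) + c * E t); last first.
      by rewrite /L; field.
    by rewrite mulrA lerDl mulr_ge0.
  by rewrite !Phi1// subrr normr0 !mulr_ge0// invr_ge0.
pose X k := iter k Phi (fun _ => 1%:M).
have cX k : cont (X k).
  by elim: k => [|k IH]; [move=> i j s; exact: cvg_cst|exact: cPhi].
have X01 s i j : `|X 1 s i j - X 0 s i j| <= M * E s.
  have [sa|/ltW sa] := leP s a.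
    by rewrite /= Phi1 ?subrr ?normr0 ?mulr_ge0//; exact: (cX 0).
  have hX (t : R) : is_derive t 1 (fun s => X 1 s i j - X 0 s i j)
      (A t i j - 0).
    apply: is_deriveB; last exact: is_derive_cst.
    by have /is_derive_mxP/(_ i j) := dPhi _ (cX 0) t; rewrite mulmx1.
  apply: (derive_bound hX (dE M) _ _ sa) => [t ta|].
    rewrite subr0 (le_trans (AM _ _ _))// ler_peMr//.
    have : 1 <= E t by rewrite -expR0 ler_expR mulr_ge0 ?subr_ge0// /L; lra.
    move: nM0; rewrite /L; nra.
  by rewrite /= Phi1 ?subrr ?normr0 ?mulr_ge0//; exact: (cX 0).
have Xk k s i j : `|X k.+1 s i j - X k s i j| <= M * E s / 2 ^+ k.
  elim: k s i j => [|k IH] s i j; first by rewrite expr0 divr1.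
  have {}IH s' i' j' : `|X k.+1 s' i' j' - X k s' i' j'| <= M / 2 ^+ k * E s'.
    by rewrite mulrAC.
  have c0 : 0 <= M / 2 ^+ k by rewrite divr_ge0 ?exprn_ge0.
  have := contr _ _ _ (cX k.+1) (cX k) c0 IH s i j.
  rewrite -[Phi (X k.+1)]/(X k.+2) -[Phi (X k)]/(X k.+1) => /le_trans; apply.
  by rewrite exprS invfM le_eqVlt; apply/orP; left; apply/eqP; ring.
have [U HU] : exists U : R -> 'M[R]_n, forall k s i j,
    `|X k s i j - U s i j| <= 2 * (M * E s) / 2 ^+ k.
  have /choice[U HU] : forall sij : R * 'I_n * 'I_n, exists l, forall k,
      `|X k sij.1.1 sij.1.2 sij.2 - l| <= 2 * (M * E sij.1.1) / 2 ^+ k.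
    by move=> [[s i] j]; apply: geometric_limit_exists => k; exact: Xk.
  exists (fun s => \matrix_(i, j) U (s, i, j)) => k s i j.
  by rewrite mxE; exact: HU (s, i, j) k.
have cU : cont U.
  move=> i j; apply: (geometric_limit_continuous
    (u := fun k s => X k s i j) (K := fun s => 2 * (M * E s))).
  - by move=> k; exact: cX.
  - move=> s; apply: differentiable_continuous; apply/derivable1_diffP.
    rewrite (_ : (fun s => _) = (fun s => 2 * M * E s)).
      by have [] := dE (2 * M) s.
    by apply/funext => t; rewrite mulrA.
  - by move=> k s; exact: HU.
(* Both [U] and [Phi U] are within [M * E s / 2 ^+ k] of the iterate [X k.+1], for every [k]. *)
have PhiU : Phi U = U.
  apply/funext => s; apply/matrixP => i j.
  apply/eqP; rewrite -subr_eq0; apply/eqP.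
  apply: (@geometric_bound_eq0 _ _ (2 * (M * E s))) => k.
  have c0 : 0 <= 2 * M / 2 ^+ k by rewrite divr_ge0 ?exprn_ge0 ?mulr_ge0.
  have {}HU' s' i' j' : `|X k s' i' j' - U s' i' j'| <= 2 * M / 2 ^+ k * E s'.
    by rewrite mulrAC -(mulrA 2).
  have := contr _ _ _ (cX k) cU c0 HU' s i j.
  rewrite -[Phi (X k)]/(X k.+1) => h1; have h2 := HU k.+1 s i j.
  rewrite (_ : _ - _ = (X k.+1 s i j - U s i j) -
    (X k.+1 s i j - Phi U s i j)); last by ring.
  rewrite (le_trans (ler_normB _ _))// (le_trans (lerD h2 h1))//.
  rewrite exprS invfM le_eqVlt; apply/orP; left; apply/eqP; field.
  by rewrite expf_neq0 ?pnatr_eq0.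
exists U; split=> s; last by rewrite -PhiU; exact: Phi1.
by rewrite -[X in is_derive _ _ X]PhiU; exact: dPhi.
Qed.

(** The derivative of [U^T *m V] is [U^T *m (A^T + A) *m V], which is zero. Taking [V := U] gives
    orthogonality; two solutions give uniqueness. *)
Lemma gram_ode (R : realType) n (A U V : R -> 'M[R]_n) (a : R) :
  (forall s, (A s)^T = - A s) ->
  (forall s : R, is_derive s 1 U (A s *m U s)) ->
  (forall s : R, is_derive s 1 V (A s *m V s)) ->
  U a = 1%:M -> V a = 1%:M -> forall s, (U s)^T *m V s = 1%:M.
Proof.
move=> hA hU hV Ua Va s.
have h (t : R) : is_derive t 1 (fun s => (U s)^T *m V s) 0.
  apply: is_derive_eq (is_derive_mulmx (is_derive_trmx (hU t)) (hV t)) _.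
  by rewrite trmx_mul hA mulmxN mulNmx mulmxA addNr.
by rewrite (is_derive0_mx_cst h s a) Ua Va trmx1 mulmx1.
Qed.

Lemma antisym_ode_unique (R : realType) n (A U V : R -> 'M[R]_n) (a : R) :
  (forall s, (A s)^T = - A s) ->
  (forall s : R, is_derive s 1 U (A s *m U s)) ->
  (forall s : R, is_derive s 1 V (A s *m V s)) ->
  U a = 1%:M -> V a = 1%:M -> U = V.
Proof.
move=> hA hU hV Ua Va; apply/funext => s.
have UU := gram_ode hA hU hU Ua Ua s.
have UV := gram_ode hA hU hV Ua Va s.
by rewrite -[LHS]mulmx1 -UV mulmxA (mulmx1C UU) mul1mx.
Qed.

(** The squares of the entries of a column sum to a diagonal entry of [U^T *m U], that is, to 1. *)
Lemma orthogonal_bound (R : realType) n (U : 'M[R]_n) :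
  U^T *m U = 1%:M -> forall i j, `|U i j| <= 1.
Proof.
move=> UU i j; have /matrixP/(_ j j) := UU; rewrite !mxE eqxx mulr1n => h.
rewrite -(ler_pXn2r (n := 2))// ?nnegrE// expr1n real_normK ?num_real// -h.
rewrite (bigD1 i)//= !mxE -expr2 lerDl sumr_ge0// => k _.
by rewrite !mxE -expr2 sqr_ge0.
Qed.

(** * The matrices H(b) *)

Lemma ord3P (P : 'I_3 -> Prop) : P 0 -> P 1 -> P 2 -> forall i, P i.
Proof.
move=> P0 P1 P2 [[|[|[|//]]] h].
- by rewrite (_ : Ordinal h = 0)//; exact: val_inj.
- by rewrite (_ : Ordinal h = 1)//; exact: val_inj.
- by rewrite (_ : Ordinal h = 2)//; exact: val_inj.
Qed.

Lemma sum3E (V : nmodType) (F : 'I_3 -> V) : \sum_k F k = F 0 + F 1 + F 2.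
Proof.
rewrite !big_ord_recr big_ord0/= add0r.
by congr (F _ + F _ + F _); exact: val_inj.
Qed.

Section HatMatrix.
Variable R : realType.
Implicit Types (b c : 'cV[R]_3) (U : 'M[R]_3).

Lemma HE b :
  ((H b 0 0 = 0) * (H b 0 1 = b 2 0) * (H b 0 2 = - b 1 0)) *
  ((H b 1 0 = - b 2 0) * (H b 1 1 = 0) * (H b 1 2 = b 0 0)) *
  ((H b 2 0 = b 1 0) * (H b 2 1 = - b 0 0) * (H b 2 2 = 0)).
Proof. by rewrite /H !mxE. Qed.

Lemma H_tr b : (H b)^T = - H b.
Proof.
by apply/matrixP; elim/ord3P; elim/ord3P; rewrite !mxE/= ?oppr0 ?opprK.
Qed.

Lemma H_lin (k : R) b c : H (k *: b + c) = k *: H b + H c.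
Proof.
by apply/matrixP; elim/ord3P; elim/ord3P; rewrite /H !mxE/=; ring.
Qed.

Lemma H_zero : H (0 : 'cV[R]_3) = 0.
Proof. by apply/matrixP; elim/ord3P; elim/ord3P; rewrite !HE !mxE ?oppr0. Qed.

Lemma H_bound b (m : R) : (forall k, `|b k 0| <= m) ->
  forall i j, `|H b i j| <= m.
Proof.
move=> bm; have m0 : 0 <= m := le_trans (normr_ge0 _) (bm 0).
by elim/ord3P; elim/ord3P; rewrite !HE ?normrN ?normr0.
Qed.

(** Indices are added modulo 3, and this cyclic order absorbs the signs of the cofactors. Column j
    is the cross product of columns j + 1 and j + 2 of [U]. *)
Definition cofactor_mx U : 'M[R]_3 := \matrix_(i, j)
  (U (i + 1) (j + 1) * U (i + 2) (j + 2) -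
   U (i + 1) (j + 2) * U (i + 2) (j + 1)).

Let ord3D : ((1 + 2 = 0 :> 'I_3) * (2 + 1 = 0 :> 'I_3)) * (2 + 2 = 1 :> 'I_3).
Proof. by do !split; exact: val_inj. Qed.

(** [H b] maps y to the cross product of y and b, so each entry on the left is a triple product of
    two columns of [U] with [b]. For a rotation the cofactor matrix is [U] itself. *)
Lemma H_conj U b : U^T *m H b *m U = H ((cofactor_mx U)^T *m b).
Proof.
have := HE b; move: (H b) => h hE.
apply/matrixP; elim/ord3P; elim/ord3P; rewrite !HE !mxE !sum3E !mxE !sum3E !mxE;
  by rewrite !hE ?add0r ?ord3D; ring.
Qed.

Lemma cofactor_mx1 : cofactor_mx 1%:M = 1%:M.
Proof.
apply/matrixP; elim/ord3P; elim/ord3P; rewrite !mxE ?add0r ?ord3D/=; ring.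
Qed.

(** By the Jacobi identity, the cross product of two solutions of y' = H(b) y is again a solution;
    the columns of the cofactor matrix are such products. *)
Lemma is_derive_cofactor_mx (U : R -> 'M[R]_3) (s : R) b :
  is_derive s 1 U (H b *m U s) ->
  is_derive s 1 (cofactor_mx \o U) (H b *m cofactor_mx (U s)).
Proof.
move=> /is_derive_mxP hU; apply/is_derive_mxP => i j.
pose u k l := fun s => U s k l.
rewrite (_ : (fun s => _) = u (i + 1) (j + 1) * u (i + 2) (j + 2) -
   u (i + 1) (j + 2) * u (i + 2) (j + 1)); last first.
  by apply/funext => t; rewrite /= mxE.
apply: is_derive_eq (is_deriveB (is_deriveM (hU _ _) (hU _ _))
  (is_deriveM (hU _ _) (hU _ _))) _.
rewrite /u /GRing.scale/=.
have := HE b; move: (H b) => h hE.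
move: i j; elim/ord3P; elim/ord3P; rewrite ?add0r ?ord3D !mxE !sum3E !hE !mxE
   ?add0r ?ord3D; ring.
Qed.

(* U and its cofactor matrix solve the same equation, hence U = cof U, i.e.
   det U = 1, along the flow. *)
Lemma cofactor_ode (U : R -> 'M[R]_3) (b : R -> 'cV[R]_3) (a : R) :
  (forall s : R, is_derive s 1 U (H (b s) *m U s)) -> U a = 1%:M ->
  forall s, cofactor_mx (U s) = U s.
Proof.
move=> hU Ua s.
have Ka : (@cofactor_mx \o U) a = 1%:M by rewrite /= Ua cofactor_mx1.
have hK := antisym_ode_unique (fun s => H_tr (b s))
  (fun s => is_derive_cofactor_mx (hU s)) hU Ka Ua.
by rewrite -[in RHS]hK.
Qed.

End HatMatrix.

(** * Translation in time and boundedness of functions with bounded support *)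

Lemma is_derive_mx_shift (R : realType) m n (M : R -> 'M[R]_(m, n))
    (a t : R) dM :
  is_derive (a + t) 1 M dM -> is_derive t 1 (fun s => M (a + s)) dM.
Proof.
move=> /is_derive_mxP hM; apply/is_derive_mxP => i j.
have ha : is_derive t (1 : R) (cst a + id) (1 : R).
  by apply: is_derive_eq; exact: add0r.
by rewrite -[dM i j]mulr1; exact: (is_derive1_comp (hM i j) ha).
Qed.

Lemma vanishing_bounded (R : realType) (f : R -> R) (T : R) :
  continuous f -> (forall s, T <= `|s| -> f s = 0) ->
  exists M, forall s, `|f s| <= M.
Proof.
move=> cf f0; have TT : - `|T| <= `|T| by rewrite ge0_cp.
have cnf : {within `[- `|T|, `|T|], continuous (fun s => `|f s|)}.
  apply: continuous_subspaceT => s.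
  exact: (continuous_comp (cf s) (@norm_continuous _ _ _)).
have [c _ hc] := EVT_max TT cnf.
exists `|f c| => s; have [Ts|sT] := leP `|T| `|s|.
  by rewrite f0 ?normr0// (le_trans (ler_norm T)).
by apply: hc; rewrite in_itv/= -ler_norml ltW.
Qed.

(** * The transport equation *)

Section Transport.
Variables (R : realType) (gammaN v : R).
Implicit Types (B : 'cV[R]_3 -> 'cV[R]_3) (x xi : 'cV[R]_3).

Definition vanishes_outside B x xi (T : R) :=
  forall s, T <= `|s| -> B (x + s *: xi) = 0.

Lemma compactly_supported_vanishes B x xi :
  compactly_supported B -> enorm xi = 1 -> exists T, vanishes_outside B x xi T.
Proof.
move=> /compact_bounded[M [_ HM]] xi1.
(* Boundedness provides a bound for every constant strictly above [M]; [M + 1] is one. *)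
have {HM} HB y : B y != 0 -> `|y| <= M + 1.
  by move=> By; apply: HM; [rewrite ltrDl|exact: subset_closure].
have xi0 : 0 < `|xi|.
  rewrite normr_gt0; apply/eqP => xi0; move: xi1; rewrite xi0 /enorm.
  rewrite big1 ?sqrtr0; first by move=> /esym/eqP; rewrite oner_eq0.
  by move=> i _; rewrite mxE expr0n.
(* Beyond this parameter the triangle inequality puts [x + s *: xi] at sup norm at least [M + 2].
   The sup norm of [xi] need not be 1, hence the division. *)
exists ((M + 2 + `|x|) / `|xi|) => s.
rewrite ler_pdivrMr// -normrZ => hs; apply/eqP; apply: contraT => /HB hB.
have : `|s *: xi| <= `|x + s *: xi| + `|x|.
  by rewrite -{1}(addKr x (s *: xi)) addrC (le_trans (ler_normB _ _)).
by move: hs hB; lra.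
Qed.

Lemma continuous_line B x xi :
  continuous B -> forall i, continuous (fun s : R => B (x + s *: xi) i 0).
Proof.
move=> cB i s.
apply: (@continuous_comp _ _ _ (fun s : R => B (x + s *: xi))
  (fun b : 'cV[R]_3 => b i 0)); last exact: coord_continuous.
apply: (@continuous_comp _ _ _ (fun s : R => x + s *: xi) B); last exact: cB.
by apply: cvgD; [exact: cvg_cst|apply: cvgZr_tmp; exact: cvg_id].
Qed.

Lemma H_continuous (b : R -> 'cV[R]_3) :
  (forall i, continuous (fun s => b s i 0)) ->
  forall i j, continuous (fun s => H (b s) i j).
Proof.
have hE (i j : 'I_3) (f : R -> R) : (forall s, H (b s) i j = f s) ->
    continuous f -> continuous (fun s => H (b s) i j).
  by move=> hf; rewrite (_ : (fun s => _) = f)//; exact/funext.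
move=> cb; elim/ord3P; elim/ord3P; (apply: hE; first by move=> s; rewrite HE);
  move=> s; solve [exact: cvg_cst|exact: cb|by apply: cvgN; exact: cb].
Qed.

Lemma H_scale (k : R) (b : 'cV[R]_3) : k *: H b = H (k *: b).
Proof. by rewrite -[k *: b]addr0 H_lin H_zero addr0. Qed.

Lemma transport_line_exists B x xi T :
  continuous B -> vanishes_outside B x xi T ->
  exists U : R -> 'M[R]_3,
    (forall s : R, is_derive s 1 U (H ((gammaN / v) *: B (x + s *: xi)) *m U s))
    /\ forall s, s <= - T -> U s = 1%:M.
Proof.
move=> cB BT.
pose A s := H ((gammaN / v) *: B (x + s *: xi)).
have cA i j : continuous (fun s => A s i j).
  apply: H_continuous => k.
  rewrite (_ : (fun s => _) = (fun s : R => (gammaN / v) * B (x + s *: xi) k 0)).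
    by move=> s; apply: cvgM; [exact: cvg_cst|exact: continuous_line].
  by apply/funext => s; rewrite mxE.
have A0 s : T <= `|s| -> A s = 0 by move=> sT; rewrite /A BT// scaler0 H_zero.
have /choice[M HM] (ij : 'I_3 * 'I_3) : exists M, forall s, `|A s ij.1 ij.2| <= M.
  apply: (@vanishing_bounded _ _ T) => [|s sT]; first exact: cA.
  by rewrite A0// mxE.
(* The sum of the nine entrywise bounds is a bound common to all entries. *)
apply: (@linear_ode_exists _ _ A (- T) (\sum_ij `|M ij|)) => //.
- move=> s sT; apply: A0; rewrite -normrN (le_trans _ (ler_norm _))//.
  by rewrite lerNr.
- by rewrite sumr_ge0.
- move=> s i j; rewrite (le_trans (HM (i, j) s))// (bigD1 (i, j))//=.
  by rewrite (le_trans (ler_norm _))// lerDl sumr_ge0.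
Qed.

(** Each pair of a base point and a direction gets its own solution along the line. Its value at
    parameter 0 depends consistently on the base point, since two base points on one line give
    translates of one solution by uniqueness. *)
Lemma transport_solution_exists B :
  continuous B ->
  (forall x xi, enorm xi = 1 -> exists T, vanishes_outside B x xi T) ->
  exists Sg, is_transport_solution gammaN v B Sg.
Proof.
move=> cB vB.
have /choice[U HU] (p : 'cV[R]_3 * 'cV[R]_3) : exists U : R -> 'M[R]_3,
    enorm p.2 = 1 ->
    (forall s : R, is_derive s 1 U (H ((gammaN / v) *: B (p.1 + s *: p.2)) *m U s))
    /\ exists T, forall s, s <= T -> U s = 1%:M.
  have [p1|p1] := pselect (enorm p.2 = 1); last by exists (fun=> 0).
  have [T /(transport_line_exists cB)[U [dU U1]]] := vB p.1 p.2 p1.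
  by exists U => _; split=> //; exists (- T).
exists (fun y xi => U (y, xi) 0) => x xi xi1.
have shiftU t : U (x + t *: xi, xi) 0 = U (x, xi) t.
  have [/= dU [T U1]] := HU (x, xi) xi1.
  have [/= dV [T' V1]] := HU (x + t *: xi, xi) xi1.
  rewrite -{2}[t]addr0.
  (* At this parameter both solutions still equal the identity. *)
  pose a := Num.min (T - t) T'.
  suff -> : U (x + t *: xi, xi) = fun s => U (x, xi) (t + s) by [].
  apply: (antisym_ode_unique (fun s => H_tr _) dV _ (a := a)).
  - move=> s; apply: is_derive_mx_shift.
    by rewrite -addrA -scalerDl; exact: dU.
  - by apply: V1; rewrite /a ge_min lexx orbT.
  - by apply: U1; rewrite -lerBrDl /a ge_min lexx.
have [/= dU [T U1]] := HU (x, xi) xi1.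
have -> : (fun s => U (x + s *: xi, xi) 0) = U (x, xi) by exact/funext.
split=> [s|].
  by rewrite shiftU scalemxAl H_scale; exact: dU.
apply: cvg_near_cst; exists T.
by split=> [|s /ltW]; [exact: num_real|exact: U1].
Qed.

(** Where the field vanishes the derivative is zero, so the solution is constant on either side; the
    limit at -oo fixes the left constant as 1. *)
Lemma transport_solution_line B Sg x xi T :
  is_transport_solution gammaN v B Sg -> enorm xi = 1 ->
  vanishes_outside B x xi T ->
  let U s := Sg (x + s *: xi) xi in
  [/\ forall s : R, is_derive s 1 U (H ((gammaN / v) *: B (x + s *: xi)) *m U s),
      forall s, s <= - T -> U s = 1%:M & forall s, T <= s -> U s = U T].
Proof.
move=> hSg xi1 BT U; have [dU limU] := hSg x xi xi1.
have {}dU (s : R) : is_derive s 1 U (H ((gammaN / v) *: B (x + s *: xi)) *m U s).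
  by rewrite -H_scale -scalemxAl; exact: dU.
have dU0 s : T <= `|s| -> H ((gammaN / v) *: B (x + s *: xi)) *m U s = 0.
  by move=> sT; rewrite BT// scaler0 H_zero mul0mx.
have Ul s : s <= - T -> U s = U (- T).
  move=> sT; apply: (is_derive0_mx_cst_itv sT dU) => t /andP[_ tT].
  by apply: dU0; rewrite -normrN (le_trans _ (ler_norm _))// lerNr.
have Ur s : T <= s -> U s = U T.
  move=> sT; apply/esym; apply: (is_derive0_mx_cst_itv sT dU) => t /andP[tT _].
  by apply: dU0; rewrite (le_trans tT) ?ler_norm.
split=> // s sT; rewrite Ul//.
apply: (@cvg_unique _ _ (U s @[s --> -oo]) _ _ _ _ limU).
  exact: norm_hausdorff.
apply: cvg_near_cst; exists (- T).
by split=> [|t /ltW]; [exact: num_real|exact: Ul].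
Qed.

Lemma forward_line B x xi T :
  is_transport_solution gammaN v B (Sigma gammaN v B) -> enorm xi = 1 ->
  vanishes_outside B x xi T ->
  forward gammaN v B x xi = Sigma gammaN v B (x + T *: xi) xi.
Proof.
move=> hSg xi1 BT; have [_ _ Ur] := transport_solution_line hSg xi1 BT.
apply: lim_near_cst; first exact: norm_hausdorff.
by exists T; split=> [|s /ltW]; [exact: num_real|exact: Ur].
Qed.

(** Existence of a solution excludes the default value of the choice. *)
Lemma SigmaP B :
  continuous B ->
  (forall x xi, enorm xi = 1 -> exists T, vanishes_outside B x xi T) ->
  is_transport_solution gammaN v B (Sigma gammaN v B).
Proof.
move=> cB vB; apply: (xgetPex (fun _ _ => 1%:M)).
exact: transport_solution_exists.
Qed.

End Transport.

(** * First-order expansion of the perturbed flow *)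

Lemma Rintegral_vanishing (R : realType) (f F : R -> R) (T : R) :
  0 < T -> continuous f -> (forall s, T <= `|s| -> f s = 0) ->
  (forall s : R, is_derive s 1 F (f s)) ->
  Rintegral (@lebesgue_measure R) setT f = F T - F (- T).
Proof.
move=> T0 cf f0 dF; have TT : - T < T by rewrite gtrN.
have cF s : {for s, continuous F}.
  by apply/differentiable_continuous/derivable1_diffP; exact: ex_derive.
transitivity (Rintegral (@lebesgue_measure R) `[- T, T] f).
  rewrite [RHS]Rintegral_mkcond; congr Rintegral; apply/funext => s.
  rewrite patchE mem_setE in_itv/= -ler_norml.
  by case: ifPn => //; rewrite -ltNge => /ltW/f0.
rewrite /Rintegral (@continuous_FTC2 _ f F)//.
- exact: continuous_subspaceT.
- split=> [s _||].
  + exact: ex_derive.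
  + exact/cvg_at_right_filter/cF.
  + exact/cvg_at_left_filter/cF.
- by move=> s _; rewrite derive1E; exact: derive_val.
Qed.

(** The difference quotient at [e] differs from [l] by at most [C * |e|]. *)
Lemma is_derive_quadratic (R : realType) (f : R -> R) (l C : R) :
  (forall e, `|f e - f 0 - e * l| <= C * e ^+ 2) -> is_derive (0 : R) 1 f l.
Proof.
move=> hf.
have C0 : 0 <= C by have := le_trans (normr_ge0 _) (hf 1); rewrite expr1n mulr1.
suff h : (fun h => h^-1 *: ((f \o shift 0) (h *: (1 : R)) - f 0)) @ 0^' --> l.
  by apply: DeriveDef; [apply/cvg_ex; exists l|exact/cvg_lim].
apply/cvgrPdist_le => e e0; near=> t.
have t0 : t != 0 by near: t; exact: nbhs_dnbhs_neq.
(* [C + 1] keeps the denominator positive when [C] is 0. *)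
have te : `|t| < e / (C + 1).
  by near: t; apply: dnbhs0_lt; rewrite divr_gt0// ltr_pwDr.
rewrite /= addr0 /GRing.scale/= mulr1 distrC.
rewrite (_ : _ - l = t^-1 * (f t - f 0 - t * l)); last by field.
rewrite normrM normfV ler_pdivrMl ?normr_gt0// (le_trans (hf t))//.
rewrite -real_normK ?num_real// expr2 mulrCA ler_wpM2l//.
move: te; rewrite ltr_pdivlMr ?ltr_pwDr// => te.
by have := normr_ge0 t; nra.
Unshelve. all: by end_near. Qed.

Lemma is_derive_H (R : realType) (F : R -> 'cV[R]_3) (s : R) dF :
  is_derive s 1 F dF -> is_derive s 1 (fun s => H (F s)) (H dF).
Proof.
move=> /is_derive_mxP hF; apply/is_derive_mxP.
have hE (i j : 'I_3) (f : R -> R) : (forall s, H (F s) i j = f s) ->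
    is_derive s 1 f (H dF i j) -> is_derive s 1 (fun s => H (F s) i j) (H dF i j).
  by move=> hf; rewrite (_ : (fun s => _) = f)//; exact/funext.
elim/ord3P; elim/ord3P; (apply: hE; first by move=> t; rewrite HE); rewrite HE;
  solve [exact: is_derive_cst|exact: hF|by apply: is_deriveN; exact: hF].
Qed.

(* W = U0^T Ue solves W' = e H(U0^T d) W; two applications of the mean value
   inequality give W = 1 + e H(F) + O(e^2). *)
Lemma perturbed_flow_expansion (R : realType) (b d F : R -> 'cV[R]_3)
    (U : R -> R -> 'M[R]_3) (a T m : R) :
  (forall e (s : R), is_derive s 1 (U e) (H (b s + e *: d s) *m U e s)) ->
  (forall e, U e a = 1%:M) ->
  (forall s i, `|d s i 0| <= m) ->
  (forall s : R, is_derive s 1 F ((U 0 s)^T *m d s)) -> F a = 0 -> a <= T ->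
  exists C, forall e i j,
    `|(U e T - U 0 T - e *: (U 0 T *m H (F T))) i j| <= C * e ^+ 2.
Proof.
move=> dU U1 dm dF F0 aT.
have m0 : 0 <= m := le_trans (normr_ge0 _) (dm 0 0).
have dU0 (s : R) : is_derive s 1 (U 0) (H (b s) *m U 0 s).
  by have := dU 0 s; rewrite scale0r addr0.
have orth e s : (U e s)^T *m U e s = 1%:M.
  exact: (gram_ode (fun s => H_tr _) (dU e) (dU e)).
have cof s : cofactor_mx (U 0 s) = U 0 s.
  exact: (cofactor_ode dU0 (U1 0)).
have Ub e s := orthogonal_bound (orth e s).
have Utb e s i j : `|(U e s)^T i j| <= 1 by rewrite mxE.
pose V s := (U 0 s)^T *m d s.
have HVb s i j : `|H (V s) i j| <= 3 * m.
  apply: H_bound => k; rewrite -[m]mul1r; apply: mulmx_bound => // i' j'.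
  by rewrite ord1.
pose W e s := (U 0 s)^T *m U e s.
(* The terms in [H (b s)] cancel by antisymmetry. In the remaining one, inserting
   [U 0 s *m (U 0 s)^T = 1] yields the conjugate of [H (d s)]. *)
have dW e (s : R) : is_derive s 1 (W e) (e *: (H (V s) *m W e s)).
  apply: is_derive_eq (is_derive_mulmx (is_derive_trmx (dU0 s)) (dU e s)) _.
  have -> : H (V s) = (U 0 s)^T *m H (d s) *m U 0 s by rewrite H_conj cof.
  rewrite /W !mulmxA.
  rewrite -(mulmxA ((U 0 s)^T *m _)) (mulmx1C (orth 0 s)) mulmx1.
  rewrite trmx_mul H_tr mulmxN mulNmx [b s + _]addrC H_lin mulmxDr mulmxDl.
  by rewrite addrC addrK -scalemxAr -scalemxAl.
have W1 e : W e a = 1%:M by rewrite /W !U1 trmx1 mulmx1.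
have Wb e s i j : `|W e s i j| <= 3.
  have := mulmx_bound (Utb 0 s) (Ub e s) i j.
  by rewrite !mulr1.
(* 27 m = 3 (3 m) 3 bounds the entries of [H (V s) *m W e s]. *)
pose k := 27 * m.
have k0 : 0 <= k by rewrite mulr_ge0.
have Wlin e s i j : a <= s -> `|W e s i j - (1%:M : 'M[R]_3) i j| <= `|e| * k * (s - a).
  move=> sa.
  have h1 (t : R) : is_derive t 1 (fun t => W e t i j - (1%:M : 'M[R]_3) i j)
      ((e *: (H (V t) *m W e t)) i j - 0).
    have /is_derive_mxP/(_ i j) hW := dW e t.
    exact: (is_deriveB hW (is_derive_cst ((1%:M : 'M[R]_3) i j) t 1)).
  have h2 (t : R) : is_derive t 1 ((`|e| * k) \*: (id - cst a)) ((`|e| * k) *: (1 - 0)).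
    exact: is_deriveZ.
  apply: (derive_bound h1 h2 _ _ sa) => [t ta|].
    rewrite !subr0 [leRHS]mulr1 scalemxE normrM ler_wpM2l//.
    apply: le_trans (mulmx_bound (HVb t) (Wb e t) i j) _.
    by rewrite /k; lra.
  by rewrite W1 subrr normr0 /= !fctE subrr [_ *: _]mulr0.
(* The second-order remainder: its derivative carries the factor [W e s - 1%:M], already O(e), next
   to [e]. *)
pose D e s := W e s - 1%:M - e *: H (F s).
have dD e (s : R) : is_derive s 1 (D e) (e *: (H (V s) *m (W e s - 1%:M))).
  apply/is_derive_mxP => i j.
  have /is_derive_mxP/(_ i j) hW := dW e s.
  have hF : is_derive s 1 (fun s => H (F s) i j) (H (V s) i j).
    by have /is_derive_mxP := is_derive_H (dF s); exact.
  rewrite (_ : (fun s => _) = (fun s => W e s i j) - cst ((1%:M : 'M[R]_3) i j) -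
    (e \*: (fun s => H (F s) i j))); last first.
    by apply/funext => t; rewrite /D !submxE scalemxE.
  apply: is_derive_eq; rewrite subr0 mulmxBr mulmx1 !scalemxE submxE.
  exact/esym/mulrBr.
(* The linear bound on [W e t - 1%:M], multiplied by 3 (3 m) for the product with [H (V t)], is
   integrated from [a] to [T]. *)
have Db e i j : `|D e T i j| <= e ^+ 2 * (k * (9 * m)) / 2 * (T - a) ^+ 2.
  have h1 (t : R) : is_derive t 1 (fun t => D e t i j)
      ((e *: (H (V t) *m (W e t - 1%:M))) i j).
    by have /is_derive_mxP := dD e t; exact.
  have h2 (t : R) : is_derive t 1 ((e ^+ 2 * (k * (9 * m)) / 2) \*: (id - cst a) ^+ 2)
       (e ^+ 2 * (k * (9 * m)) * (t - a)).
    have h0 : is_derive t (1 : R) (id - cst a) (1 - 0) by exact: is_deriveB.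
    apply: is_derive_eq.
    by rewrite !fctE /GRing.scale/= expr1 subr0; field.
  apply: (derive_bound h1 h2 _ _ aT) => [t ta|].
    have {}Wlin i' j' : `|(W e t - 1%:M) i' j'| <= `|e| * k * (t - a).
      by rewrite submxE; exact: Wlin.
    rewrite scalemxE normrM.
    rewrite -real_normK ?num_real// expr2 -!mulrA ler_wpM2l//.
    apply: le_trans (mulmx_bound (HVb t) Wlin i j) _.
    by rewrite le_eqVlt; apply/orP; left; apply/eqP; rewrite /k; ring.
  rewrite /D W1 F0 H_zero scaler0 subr0 subrr mxE normr0 /= !fctE subrr.
  by rewrite expr0n/= [_ *: _]mulr0.
(* The outer 3 comes from multiplying [D e T] by [U 0 T], whose entries are at most 1 in absolute
   value. *)
exists (3 * (k * (9 * m) / 2 * (T - a) ^+ 2)) => e i j.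
have -> : U e T - U 0 T - e *: (U 0 T *m H (F T)) = U 0 T *m D e T.
  rewrite /D /W !mulmxBr mulmx1 mulmxA (mulmx1C (orth 0 T)) mul1mx.
  by rewrite -scalemxAr.
apply: le_trans (mulmx_bound (Ub 0 T) (Db e) i j) _.
by rewrite le_eqVlt; apply/orP; left; apply/eqP; ring.
Qed.

(** * Differentiation of the forward map *)

Theorem mainTheorem2 (R : realType) (gammaN v : R)
    (hgamma : gammaN != 0) (hv : 0 < v)
    (B dB : 'cV[R]_3 -> 'cV[R]_3)
    (smB : smooth B) (csB : compactly_supported B)
    (smdB : smooth dB) (csdB : compactly_supported dB)
    (x xi : 'cV[R]_3) (hxi : enorm xi = 1) :
  derivable (perturbed_forward gammaN v B dB x xi) 0 1 /\
  gateaux_forward gammaN v B dB x xi =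
    (gammaN / v) *:
      (forward gammaN v B x xi *m
       H (integral_cV (fun s : R =>
            (Sigma gammaN v B (x + s *: xi) xi)^T *m dB (x + s *: xi)))).
Proof.
have cB : continuous B by have [] := smB 0.
have cdB : continuous dB by have [] := smdB 0.
pose Be e y := B y + e *: dB y.
have cBe e : continuous (Be e).
  by move=> y; apply: (cvgD (cB y)); apply: cvgZl_tmp; exact: cdB.
have vBoth y eta : enorm eta = 1 -> exists T, [/\ 0 < T,
    vanishes_outside B y eta T & vanishes_outside dB y eta T].
  move=> eta1.
  have [T1 B0] := compactly_supported_vanishes y csB eta1.
  have [T2 dB0] := compactly_supported_vanishes y csdB eta1.
  (* The 1 ensures [0 < T], as the integral over [-T, T] requires. *)
  exists (Num.max 1 (Num.max T1 T2)); split; first by rewrite lt_max ltr01.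
    by move=> s; rewrite !ge_max => /and3P[_ + _] => /B0.
  by move=> s; rewrite !ge_max => /and3P[_ _ /dB0].
have vBe T y eta e : vanishes_outside B y eta T -> vanishes_outside dB y eta T ->
    vanishes_outside (Be e) y eta T.
  by move=> B0 dB0 s sT; rewrite /Be B0// dB0// scaler0 addr0.
have solBe e : is_transport_solution gammaN v (Be e) (Sigma gammaN v (Be e)).
  apply: SigmaP => // y eta /(vBoth y)[T [_ B0 dB0]].
  by exists T; exact: vBe.
have [T [T0 B0 dB0]] := vBoth x xi hxi.
have Be0 : Be 0 = B by apply/funext => y; rewrite /Be scale0r addr0.
pose g := gammaN / v; pose b s := g *: B (x + s *: xi).
pose d s := g *: dB (x + s *: xi).
pose U e s := Sigma gammaN v (Be e) (x + s *: xi) xi.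
(* The same [T] serves for every [e], so the limit at +oo becomes evaluation at one point. *)
have forwardE e : forward gammaN v (Be e) x xi = U e T.
  by apply: forward_line => //; exact: vBe.
have dU e (s : R) : is_derive s 1 (U e) (H (b s + e *: d s) *m U e s).
  have [dU _ _] := transport_solution_line (solBe e) hxi (vBe _ _ _ e B0 dB0).
  rewrite (_ : b s + _ = g *: Be e (x + s *: xi)); first exact: dU.
  by rewrite /b /d /Be scalerDr !scalerA (mulrC e).
have U1 e : U e (- T) = 1%:M.
  have [_ + _] := transport_solution_line (solBe e) hxi (vBe _ _ _ e B0 dB0).
  exact.
pose f s := (U 0 s)^T *m dB (x + s *: xi).
have cf i : continuous (fun s => f s i 0).
  move=> s; apply: continuous_mulmx => [j k|j k]; last first.
    by rewrite ord1; exact: continuous_line.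
  rewrite (_ : (fun s => _) = (fun s => U 0 s k j)).
    exact: is_derive_mx_continuous (dU 0) _ _.
  by apply/funext => t; rewrite mxE.
have f0 s i : T <= `|s| -> f s i 0 = 0.
  by move=> sT; rewrite /f dB0// mulmx0 mxE.
have f0l s i : s <= - T -> f s i 0 = 0.
  by move=> sT; rewrite f0// -normrN (le_trans _ (ler_norm _))// lerNr.
(* As [F i] vanishes up to [- T], its value at [T] is the integral over the whole line. *)
have /choice[F HF] (i : 'I_3) := antiderivative_exists (cf i) (f0l ^~ i).
have /choice[m Hm] (i : 'I_3) : exists m, forall s, `|d s i 0| <= m.
  apply: (@vanishing_bounded _ _ T) => [s|s sT]; last first.
    by rewrite /d dB0// scaler0 mxE.
  rewrite (_ : (fun s => _) = (fun s : R => g * dB (x + s *: xi) i 0)).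
    by apply: cvgM; [exact: cvg_cst|exact: continuous_line].
  by apply/funext => t; rewrite mxE.
pose I := integral_cV f.
have IE : I = \col_i F i T.
  apply/colP => i; rewrite !mxE; have [dF F0] := HF i.
  by rewrite (Rintegral_vanishing T0 (cf i) (f0 ^~ i) dF) (F0 (- T))// subr0.
have dgF (s : R) : is_derive s 1 (fun s => g *: \col_i F i s) ((U 0 s)^T *m d s).
  apply/is_derive_mxP => i j; rewrite ord1 /d -scalemxAr mxE.
  rewrite (_ : (fun s => _) = g \*: F i); last first.
    by apply/funext => t; rewrite !mxE.
  by apply: is_deriveZ; have [dF _] := HF i; exact: dF.
have gF0 : g *: (\col_i F i (- T)) = 0.
  apply/colP => i; have [_ F0] := HF i; by rewrite !mxE F0 ?mulr0.
have dm s i : `|d s i 0| <= \sum_k `|m k|.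
  rewrite (le_trans (Hm i s))// (le_trans (ler_norm _))// (bigD1 i)//= lerDl.
  by rewrite sumr_ge0.
have aT : - T <= T by rewrite ge0_cp// ltW.
have [C HC] := perturbed_flow_expansion dU U1 dm dgF gF0 aT.
(* The expansion bounds each entry by [C * e ^+ 2], which gives differentiability together with the
   value of the derivative. *)
have main : is_derive (0 : R) 1 (perturbed_forward gammaN v B dB x xi)
    (g *: (U 0 T *m H I)).
  apply/is_derive_mxP => i j; apply: (@is_derive_quadratic _ _ _ C) => e.
  rewrite /perturbed_forward -/(Be e) -/(Be 0) !forwardE.
  have := HC e i j.
  by rewrite -H_scale -IE -scalemxAr !submxE scalemxE.
split; first exact: ex_derive.
rewrite /gateaux_forward derive1E (derive_val (is_derive := main)).
by rewrite -Be0 forwardE.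
Qed.
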